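(* In the multi-period market described in the context, let $D$ be the time consistent equilibrium price process and $Q^*$ the time consistent equilibrium pricing measure defined in the context. If the dividend $\varphi=0$, then the traded assets $\{C_{t_n}\}_{n=0,1,\dots,N}$ and $\{D_{t_n}\}_{n=0,1,\dots,N}$ are martingales under $Q^*$.
   Context: Time grid: $t_n=nh$, $n=0,\dots,N$, $h=T/N$, $T>0$ fixed. For a process $Z$, $\Delta Z_{t_n}=Z_{t_{n+1}}-Z_{t_n}$. Noise: $(b^1,\dots,b^d)$ is a $d$-dimensional symmetric binomial random walk on a complete filtered probability space $(\Omega,\mathcal F,\{\mathcal F_{t_n}\},\mathbb P)$, adapted to the filtration, with $\mathbb P(\Delta b^i_{t_n}=\pm1)=1/2$ for each $i$ and with increments $\Delta b_{t_n}$ independent of $\mathcal F_{t_n}$. Assets: the riskless bond is the numeraire (zero interest rate). The primary traded asset satisfies $\Delta C_{t_n}=C_{t_n}(\mu^c_{t_n}h+\sigma^c_{t_n}\sqrt h\,\Delta b^1_{t_n})$, $C_0=c>0$, with adapted drift $\mu^c$ and volatility $\sigma^c$ chosen so that $C$ stays positive. There is a non-traded asset $S$, $\Delta S_{t_n}=S_{t_n}(\mu^s_{t_n}h+\sigma^s_{t_n}\sqrt h(\rho\Delta b^1_{t_n}+\sqrt{1-\rho^2}\,\Delta b^2_{t_n}))$, $S_0=s>0$, $|\rho|<1$, with adapted $\mu^s,\sigma^s$. A derivative security $D$, written on $C$ and $S$, has a given $\mathcal F_{t_N}$-measurable terminal payoff $D_{t_N}$ and pays dividend $\varphi(t_n,C_{t_n},S_{t_n})h$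 for holding it on $[t_n,t_{n+1}]$. The market price of risk is $r^c_{t_n}=\mu^c_{t_n}/\sigma^c_{t_n}$, assumed positive, and $h$ is small enough that $r^c_{t_n}\sqrt h<1$. The representative agent has adapted risk aversion process $\gamma_{t_n}>0$ and receives an $\mathcal F_T$-measurable random income $I_{t_N}$ at $t_N=T$. All expectations written are assumed finite. Notation: $A_{t_k}=\{\Delta b^1_{t_k}=1\}$, $A^c_{t_k}=\{\Delta b^1_{t_k}=-1\}$; $\mathbb E_{t_k}[\cdot]=\mathbb E[\cdot|\mathcal F_{t_k}]$ (similarly under other measures); $\mathbb E_{t_k}[Z|A]$ denotes $\mathbb E[Z1_A|\mathcal F_{t_k}]/\mathbb P(A|\mathcal F_{t_k})$. The time consistent equilibrium price and pricing measure are given by the following backward recursion, for $k=N-1,\dots,0$ (empty sums are $0$): $$e^{-\gamma_{t_k}Y^*_{t_{k+1}}}=\mathbb E_{t_{k+1}}\Big[e^{-\gamma_{t_k}[\sum_{j=k+1}^{N-1}\Delta X^*_{t_j}+I_{t_N}]}\Big],$$ $$\Delta X^*_{t_j}=\alpha^*_{t_j}(\mu^c_{t_j}h+\sqrt h\sigma^c_{t_j}\Delta b^1_{t_j})+\Delta D_{t_j}+\varphi(t_j,C_{t_j},S_{t_j})h,$$ $$\alpha^*_{t_k}=\frac{1}{2\gamma_{t_k}\sigma^c_{t_k}\sqrt h}\log\left(\frac{1+r^c_{t_k}\sqrt h}{1-r^c_{t_k}\sqrt h}\right)+\frac{1}{2\gamma_{t_k}\sigma^c_{t_k}\sqrt h}\log\left(\frac{\mathbb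 E_{t_k}[e^{-\gamma_{t_k}[D_{t_{k+1}}+Y^*_{t_{k+1}}]}|A_{t_k}]}{\mathbb E_{t_k}[e^{-\gamma_{t_k}[D_{t_{k+1}}+Y^*_{t_{k+1}}]}|A^c_{t_k}]}\right),$$ $$\Lambda^*_{t_{k+1}}=\lambda_{t_k}\frac{e^{-\gamma_{t_k}[D_{t_{k+1}}+Y^*_{t_{k+1}}]}}{\mathbb E_{t_k}[e^{-\gamma_{t_k}[D_{t_{k+1}}+Y^*_{t_{k+1}}]}|A_{t_k}]}\ \text{on }A_{t_k},\qquad \Lambda^*_{t_{k+1}}=\lambda_{t_k}\frac{e^{-\gamma_{t_k}[D_{t_{k+1}}+Y^*_{t_{k+1}}]}}{\mathbb E_{t_k}[e^{-\gamma_{t_k}[D_{t_{k+1}}+Y^*_{t_{k+1}}]}|A^c_{t_k}]}\ \text{on }A^c_{t_k},$$ with $\lambda_{t_k}=1-r^c_{t_k}\sqrt h$ on $A_{t_k}$ and $\lambda_{t_k}=1+r^c_{t_k}\sqrt h$ on $A^c_{t_k}$. The measure $Q^*$ is defined by $\frac{dQ^*}{d\mathbb P}=\Lambda^*_{t_N}\Lambda^*_{t_{N-1}}\cdots\Lambda^*_{t_1}$, and the time consistent equilibrium price is $D_{t_k}=\mathbb E^{Q^*}_{t_k}[D_{t_{k+1}}+\varphi(t_k,C_{t_k},S_{t_k})h]$. *)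

(* Defs.v *)
(* Library: MathComp-Analysis. *)
From HB Require Import structures.
From mathcomp Require Import all_boot all_order all_algebra.
From mathcomp Require Import all_classical all_reals all_analysis.

Set Implicit Arguments.
Unset Strict Implicit.
Unset Printing Implicit Defensive.

Import Order.TTheory GRing.Theory Num.Theory.
Import numFieldNormedType.Exports.

Local Open Scope classical_set_scope.
Local Open Scope ring_scope.

(* Processes are functions nat -> Omega -> R (time index first); only the
   indices 0, ..., N carry information. *)
Definition incr (R : realType) (Omega : Type) (Z : nat -> Omega -> R)
  (n : nat) (w : Omega) : R := Z n.+1 w - Z n w.

(* Real random variable measurable with respect to the sub-sigma-algebra G. *)
Definition measurable_wrt (R : realType) (Omega : Type)
  (G : set (set Omega)) (X : Omega -> R) : Prop :=
  preimage_set_system setT X measurable `<=` G.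

Definition adapted (R : realType) (Omega : Type)
  (N : nat) (F : nat -> set (set Omega)) (Z : nat -> Omega -> R) : Prop :=
  forall n, (n <= N)%N -> measurable_wrt (F n) (Z n).

(* The last clause is the completeness of the filtered space; with the second
   one it also makes P itself complete. *)
Definition complete_filtration (R : realType) (disp : measure_display)
  (Omega : measurableType disp) (P : probability Omega R)
  (N : nat) (F : nat -> set (set Omega)) : Prop :=
  [/\ forall n, (n <= N)%N -> sigma_algebra setT (F n),
      forall n, (n <= N)%N -> F n `<=` measurable,
      forall m n, (m <= n <= N)%N -> F m `<=` F n
    & P.-negligible `<=` F 0%N].

(* Independence of the vector (X i)_i, through the sigma-algebra it generates,
   from the sigma-algebra G. *)
Definition vector_independent (R : realType) (disp : measure_display)
  (Omega : measurableType disp) (P : probability Omega R)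
  (I : Type) (X : I -> Omega -> R) (G : set (set Omega)) : Prop :=
  forall A B : set Omega,
    <<s \bigcup_(i in [set: I]) preimage_set_system setT (X i) measurable >> A ->
    G B -> P (A `&` B) = (P A * P B)%E.

(* The components of one increment need not be independent of each other. *)
Definition binomial_random_walk (R : realType) (disp : measure_display)
  (Omega : measurableType disp) (P : probability Omega R)
  (N : nat) (F : nat -> set (set Omega))
  (dim : nat) (b : 'I_dim -> nat -> Omega -> R) : Prop :=
  [/\ forall i, adapted N F (b i),
      forall i n, (n < N)%N ->
        P [set w | incr (b i) n w = 1] = (2^-1)%:E /\
        P [set w | incr (b i) n w = -1] = (2^-1)%:E
    & forall n, (n < N)%N ->
        vector_independent P (fun i => incr (b i) n) (F n)].

(* Y is a version of the conditional expectation of X given G under mu; the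
   existence of the expectation (mu-integrability of X) is part of it. *)
Definition is_cond_exp (R : realType) (disp : measure_display)
  (Omega : measurableType disp) (mu : {measure set Omega -> \bar R})
  (G : set (set Omega)) (X Y : Omega -> R) : Prop :=
  [/\ mu.-integrable setT (EFin \o X),
      mu.-integrable setT (EFin \o Y),
      measurable_wrt G Y
    & forall A, G A ->
        (\int[mu]_(w in A) (X w)%:E = \int[mu]_(w in A) (Y w)%:E)%E].

(* V is a version of E[Z | A] given G, i.e. of E[Z 1_A | G] / P(A | G). *)
Definition is_cond_exp_on (R : realType) (disp : measure_display)
  (Omega : measurableType disp) (P : probability Omega R)
  (G : set (set Omega)) (A : set Omega) (Z V : Omega -> R) : Prop :=
  exists num den : Omega -> R,
    [/\ is_cond_exp P G (fun w => Z w * \1_A w) num,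
        is_cond_exp P G (\1_A) den
      & {ae P, forall w, V w = num w / den w}].

Definition martingale (R : realType) (disp : measure_display)
  (Omega : measurableType disp) (mu : {measure set Omega -> \bar R})
  (N : nat) (F : nat -> set (set Omega)) (M : nat -> Omega -> R) : Prop :=
  [/\ adapted N F M,
      forall n, (n <= N)%N -> mu.-integrable setT (EFin \o M n)
    & forall m n, (m <= n <= N)%N -> is_cond_exp mu (F m) (M n) (M m)].

(* Main.v *)
Require Import Defs.
From HB Require Import structures.
From mathcomp Require Import all_boot all_order all_algebra.
From mathcomp Require Import all_classical all_reals all_analysis.
From mathcomp Require Import measurable_realfun ring lra.

Set Implicit Arguments.
Unset Strict Implicit.
Unset Printing Implicit Defensive.

Import Order.TTheory GRing.Theory Num.Theory.
Import numFieldNormedType.Exports.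

Local Open Scope classical_set_scope.
Local Open Scope ring_scope.

(** Why the prices are martingales under Q.

    For D this is the defining recursion of the price: with zero dividend it
    says that D k is the conditional expectation of D (k+1) under Q, and the
    tower property chains the steps ([martingale_of_steps]).

    For C the point is that the density over one period is built to price C.
    Let A be the up-move of the first walk, Ac the down-move, and put
    q = r * sqrt h.  By independence of the increments, given F k the event A
    has conditional probability 1/2; hence dividing Z by its conditional mean EA
    on A produces a weight Z / EA whose conditional expectation on A is 1/2,
    whatever the positive variable Z is ([cond_exp_on_fair]).  The same holds
    on Ac.  So the one-period density Lambda gives A the conditional mass
    (1 - q) / 2 and Ac the mass (1 + q) / 2 ([fair_density_split]): these add
    up to 1, and since
    mu h = q * (sigma sqrt h) by the definition of r, they also give C mean
    relative return
    mu h + sigma sqrt h * ((1 - q) / 2 - (1 + q) / 2)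
    = mu h - q sigma sqrt h = 0
    ([fair_density_martingale], [fair_density_asset]).  The partial products of
    the Lambda's are thus a P-martingale, a test function measurable at time k
    is integrated under Q with the product of the first k densities only
    ([abs_exp_change_of_measure]), and the one-period computation transfers to
    Q ([density_process_martingale]).

    C is not assumed integrable, under P or under Q.  Everything is therefore
    computed with integrals of nonnegative functions, which always exist:
    conditional expectations are first extended from sets to arbitrary
    nonnegative weights by monotone approximation ([integral_weight_eq]), and
    the integrability of C under Q comes out as the value c of its Q-integral.
    Since the hypotheses determine the processes only almost everywhere, the
    completeness of the filtration is what makes them measurable
    ([measurable_wrt_ae]). *)

(** * Measurability with respect to a sub-sigma-algebra *)

(** Taking G as the measurable structure of the domain reduces the closure
    properties below to those of ordinary measurable functions. *)
Lemma measurable_wrtP (R : realType) (Omega : pointedType)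
  (G : set (set Omega)) (X : Omega -> R) : sigma_algebra setT G ->
  measurable_wrt G X <->
  measurable_fun setT (X : g_sigma_algebraType G -> R).
Proof.
move=> sG; split.
  move=> hX _ B mB; rewrite measurable_g_measurableTypeE//.
  by apply: hX; exists B.
move=> mX _ [B mB <-].
by rewrite -(measurable_g_measurableTypeE sG); exact: mX.
Qed.

Section measurable_wrt_closure.
Context (R : realType) (Omega : pointedType) (G : set (set Omega)).
Context (sG : sigma_algebra setT G).
Implicit Types X Y : Omega -> R.

Lemma measurable_wrt_cst (x : R) : measurable_wrt G (fun _ : Omega => x).
Proof. by apply/measurable_wrtP => //; exact: measurable_cst. Qed.

Lemma measurable_wrt_comp (f : R -> R) X : measurable_fun setT f ->
  measurable_wrt G X -> measurable_wrt G (fun w => f (X w)).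
Proof.
move=> mf /(measurable_wrtP _ sG) mX; apply/(measurable_wrtP _ sG).
exact: measurableT_comp.
Qed.

Lemma measurable_wrtD X Y : measurable_wrt G X -> measurable_wrt G Y ->
  measurable_wrt G (fun w => X w + Y w).
Proof.
move=> /(measurable_wrtP _ sG) mX /(measurable_wrtP _ sG) mY.
by apply/(measurable_wrtP _ sG); exact: measurable_funD.
Qed.

Lemma measurable_wrtM X Y : measurable_wrt G X -> measurable_wrt G Y ->
  measurable_wrt G (fun w => X w * Y w).
Proof.
move=> /(measurable_wrtP _ sG) mX /(measurable_wrtP _ sG) mY.
by apply/(measurable_wrtP _ sG); exact: measurable_funM.
Qed.

Lemma measurable_wrtN X : measurable_wrt G X ->
  measurable_wrt G (fun w => - X w).
Proof. by apply: measurable_wrt_comp; exact: oppr_measurable. Qed.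

Lemma measurable_wrtB X Y : measurable_wrt G X -> measurable_wrt G Y ->
  measurable_wrt G (fun w => X w - Y w).
Proof. by move=> mX /measurable_wrtN; exact: measurable_wrtD. Qed.

Lemma measurable_wrt_norm X : measurable_wrt G X ->
  measurable_wrt G (fun w => `|X w|).
Proof. by apply: measurable_wrt_comp; exact: normr_measurable. Qed.

Lemma measurable_wrt_exp X : measurable_wrt G X ->
  measurable_wrt G (fun w => expR (X w)).
Proof. by apply: measurable_wrt_comp; exact: measurable_expR. Qed.

Lemma measurable_wrt_inv X : measurable_wrt G X ->
  measurable_wrt G (fun w => (X w)^-1).
Proof.
apply: (@measurable_wrt_comp (fun x => x^-1)).
(* Inversion extended by 0 at 0 is not continuous; this writes it as a product
   of functions whose measurability is known. *)
have -> : (fun x : R => x^-1) = (fun x => x * expR (- ln (x ^+ 2))).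
  apply/funext => x; have [->|x0] := eqVneq x 0; first by rewrite invr0 mul0r.
  by rewrite expRN lnK ?posrE ?exprn_even_gt0// expr2 invfM mulrA divff// mul1r.
apply: measurable_funM; first exact: measurable_id.
apply: measurableT_comp; first exact: measurable_expR.
apply: measurableT_comp; first exact: oppr_measurable.
apply: measurableT_comp; first exact: measurable_ln.
exact: exprn_measurable.
Qed.

Lemma measurable_wrt_div X Y : measurable_wrt G X -> measurable_wrt G Y ->
  measurable_wrt G (fun w => X w / Y w).
Proof. by move=> mX /measurable_wrt_inv; exact: measurable_wrtM. Qed.

Lemma measurable_wrt_indic (A : set Omega) : G A ->
  measurable_wrt G (\1_A : Omega -> R).
Proof.
move=> GA; apply/(measurable_wrtP _ sG); apply: measurable_indic.
by rewrite measurable_g_measurableTypeE.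
Qed.

Lemma measurable_wrt_le0 X : measurable_wrt G X -> G [set w | X w <= 0].
Proof.
move=> mX; apply: mX; exists `]-oo, 0]%classic; first exact: measurable_itv.
by rewrite setTI; apply/seteqP; split => w /=; rewrite in_itv.
Qed.

Lemma measurable_wrt_set1 X (x : R) : measurable_wrt G X ->
  G [set w | X w = x].
Proof.
move=> mX; apply: mX; exists [set x]; first exact: measurable_set1.
by rewrite setTI.
Qed.

End measurable_wrt_closure.

Lemma measurable_wrtS (R : realType) (Omega : Type) (G H : set (set Omega))
  (X : Omega -> R) : G `<=` H -> measurable_wrt G X -> measurable_wrt H X.
Proof. by move=> GH mX A /mX /GH. Qed.

Lemma measurable_wrt_measurable (R : realType) (disp : measure_display)
  (Omega : measurableType disp) (G : set (set Omega)) (X : Omega -> R) :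
  G `<=` measurable -> measurable_wrt G X -> measurable_fun setT X.
Proof. by move=> Gm mX _ B mB; apply/Gm/mX; exists B. Qed.

(** Off the negligible set where they differ, the preimages by Y are preimages
    by X; the part inside it is negligible, hence in G. *)
Lemma measurable_wrt_ae (R : realType) (disp : measure_display)
  (Omega : measurableType disp) (P : {measure set Omega -> \bar R})
  (G : set (set Omega)) (X Y : Omega -> R) : sigma_algebra setT G ->
  P.-negligible `<=` G -> {ae P, forall w, X w = Y w} ->
  measurable_wrt G X -> measurable_wrt G Y.
Proof.
move=> sG nG aeXY mX _ [B mB <-].
pose E := [set w | X w = Y w].
have GCE : G (~` E) by exact: nG.
have -> : setT `&` Y @^-1` B =
    (X @^-1` B `\` ~` E) `|` (Y @^-1` B `&` ~` E).
  rewrite setTI; apply/seteqP; split => w /=.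
    move=> YB; have [e|e] := pselect (E w); last by right; split.
    by left; split; [rewrite /= e|exact].
  by move=> [[XB /contrapT <-]//|[]].
rewrite -(measurable_g_measurableTypeE sG).
apply: measurableU; last first.
  rewrite measurable_g_measurableTypeE//; apply: nG.
  by apply: negligibleS aeXY => w [].
apply: measurableD; rewrite measurable_g_measurableTypeE//.
by rewrite -[_ @^-1` _]setTI; apply: mX; exists B.
Qed.


(** * Weighted integrals *)

Lemma g_sigma_algebra_sub (Omega : pointedType) (G : set (set Omega)) :
  sigma_algebra setT G -> G.-sigma.-measurable `<=` G.
Proof. by move=> /measurable_g_measurableTypeE ->. Qed.

Import HBNNSimple.

Lemma integral_nnsfun_weight (R : realType) (disp : measure_display)
  (Omega : measurableType disp) (mu : {measure set Omega -> \bar R})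
  (G : set (set Omega)) (sG : sigma_algebra setT G) (Gm : G `<=` measurable)
  (h : {nnsfun g_sigma_algebraType G >-> R}) (f : Omega -> \bar R) :
  measurable_fun setT f -> (forall w, 0 <= f w)%E ->
  (\int[mu]_w ((h w)%:E * f w) =
   \sum_(r \in range h) r%:E * \int[mu]_(w in h @^-1` [set r]) f w)%E.
Proof.
move=> mf f0.
have mh r : measurable (h @^-1` [set r] : set Omega).
  by apply/Gm/(g_sigma_algebra_sub sG).
have mindic (r : R) : measurable_fun setT
    (fun w : Omega => (\1_(h @^-1` [set r]) w)%:E : \bar R).
  by apply/measurable_EFinP; exact: measurable_indic.
transitivity (\int[mu]_w \sum_(r \in range h)
    ((r * \1_(h @^-1` [set r]) w)%:E * f w))%E.
  apply: eq_integral => w _.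
  rewrite -ge0_mule_fsuml => [|r]; last exact: nnfun_muleindic_ge0.
  by rewrite fsumEFin// -fimfunE.
rewrite ge0_integral_fsum//; last 2 first.
- move=> r; apply: emeasurable_funM => //.
  by under eq_fun do rewrite EFinM; exact: emeasurable_funM.
- by move=> r w _; rewrite mule_ge0// nnfun_muleindic_ge0.
apply: eq_fsbigr => r rh.
under eq_integral do rewrite EFinM -muleA.
rewrite ge0_integralZl//.
- under eq_integral do rewrite muleC.
  rewrite [in RHS]integral_mkcond; congr (_ * _)%E.
  by apply: eq_integral => w _; rewrite epatch_indic.
- exact: emeasurable_funM.
- by move=> w _; rewrite mule_ge0// lee_fin.
- by move: rh; rewrite inE => -[w _ <-]; rewrite lee_fin.
Qed.

(** Two densities with the same integrals over G have the same integrals against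
    every nonnegative G-measurable weight, because such a weight is an
    increasing limit of simple functions over G.  With [nu] another measure and
    [g = 1] this is a change of measure; with [g] a conditional expectation of
    [f] it takes out what is known. *)
Lemma integral_weight_eq (R : realType) (disp : measure_display)
  (Omega : measurableType disp) (mu nu : {measure set Omega -> \bar R})
  (G : set (set Omega)) (sG : sigma_algebra setT G) (Gm : G `<=` measurable)
  (f g : Omega -> R) :
  measurable_fun setT f -> measurable_fun setT g ->
  (forall w, 0 <= f w) -> (forall w, 0 <= g w) ->
  (forall B, G B ->
    \int[mu]_(w in B) (f w)%:E = \int[nu]_(w in B) (g w)%:E)%E ->
  forall V : Omega -> R, measurable_wrt G V -> (forall w, 0 <= V w) ->
  (\int[mu]_w (V w * f w)%:E = \int[nu]_w (V w * g w)%:E)%E.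
Proof.
move=> mf mg f0 g0 fg V mV V0.
have mEV : measurable_fun setT (EFin \o V : g_sigma_algebraType G -> \bar R).
  by apply/measurable_EFinP/measurable_wrtP.
have V0' : forall w : g_sigma_algebraType G,
  setT w -> (0 <= (EFin \o V) w)%E by move=> w _; rewrite lee_fin.
pose h := nnsfun_approx measurableT mEV.
have lim_int (m : {measure set Omega -> \bar R}) (k : Omega -> R) :
    measurable_fun setT k -> (forall w, 0 <= k w) ->
    (\int[m]_w (V w * k w)%:E =
     limn (fun n => \int[m]_w ((h n w)%:E * (k w)%:E)))%E.
  move=> mk k0.
  have -> : (fun w => (V w * k w)%:E) =
      (fun w => limn (fun n => (h n w)%:E * (k w)%:E)%E).
    apply/funext => w; rewrite EFinM; apply/esym/cvg_lim => //.
    have cv : (fun n => (h n w)%:E) @ \oo --> (V w)%:E.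
      exact: (cvg_nnsfun_approx measurableT mEV V0').
    exact: cvgeZr.
  apply: monotone_convergence => //.
  - move=> n; apply: emeasurable_funM; apply/measurable_EFinP => //.
    apply: (measurable_wrt_measurable Gm); apply/(measurable_wrtP _ sG).
    exact: measurable_funPT.
  - by move=> n w _; rewrite mule_ge0// lee_fin.
  - move=> w _ a b ab; rewrite lee_wpmul2r ?lee_fin//.
    by have /lefP := nd_nnsfun_approx measurableT mEV ab; exact.
rewrite (lim_int mu f mf f0) (lim_int nu g mg g0).
congr (limn _); apply/funext => n.
rewrite (integral_nnsfun_weight mu sG Gm (h n)); first last;
  [by move=> w; rewrite lee_fin|exact/measurable_EFinP|].
rewrite (integral_nnsfun_weight nu sG Gm (h n)); first last;
  [by move=> w; rewrite lee_fin|exact/measurable_EFinP|].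
apply: eq_fsbigr => r _; congr (_ * _)%E; apply: fg.
exact: g_sigma_algebra_sub.
Qed.

(** * Absolute expectations and conditional expectations *)

(** The absolute value makes the quantity meaningful without integrability and
    insensitive to the sign a version takes on a negligible set. *)
Definition abs_exp (R : realType) (disp : measure_display)
  (Omega : measurableType disp) (mu : {measure set Omega -> \bar R})
  (f : Omega -> R) : \bar R := (\int[mu]_w `|f w|%:E)%E.

Section abs_exp.
Context (R : realType) (disp : measure_display) (Omega : measurableType disp).
Context (mu : {measure set Omega -> \bar R}).
Implicit Types f g V X Y : Omega -> R.

Lemma ae_measurable_fun_real f g : measure_is_complete mu ->
  {ae mu, forall w, f w = g w} -> measurable_fun setT f ->
  measurable_fun setT g.
Proof.
move=> cmu fg mf; apply/measurable_EFinP.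
apply: (ae_measurable_fun cmu (f := EFin \o f)); last exact/measurable_EFinP.
by apply: filterS fg => w /= ->.
Qed.

Lemma abs_exp_ae f g : measure_is_complete mu -> measurable_fun setT f ->
  {ae mu, forall w, f w = g w} -> abs_exp mu f = abs_exp mu g.
Proof.
move=> cmu mf fg; have mg := ae_measurable_fun_real cmu fg mf.
apply: ge0_ae_eq_integral => //.
- by apply/measurable_EFinP; exact: measurableT_comp.
- by apply/measurable_EFinP; exact: measurableT_comp.
- by apply: filterS fg => w /= ->.
Qed.

Lemma abs_expD f g : measurable_fun setT f -> measurable_fun setT g ->
  {ae mu, forall w, `|f w + g w| = `|f w| + `|g w|} ->
  (abs_exp mu (fun w => f w + g w)%R = abs_exp mu f + abs_exp mu g)%E.
Proof.
move=> mf mg fg.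
have mnf : measurable_fun setT (fun w => `|f w|%:E).
  by apply/measurable_EFinP; exact: measurableT_comp.
have mng : measurable_fun setT (fun w => `|g w|%:E).
  by apply/measurable_EFinP; exact: measurableT_comp.
rewrite /abs_exp -ge0_integralD//.
apply: ge0_ae_eq_integral => //.
- apply/measurable_EFinP; apply: measurableT_comp => //.
  exact: measurable_realfun.measurable_funD.
- exact: emeasurable_funD.
- by move=> w _; rewrite adde_ge0.
- by apply: filterS fg => w /= ->.
Qed.

Lemma integral_abs_ae (X : Omega -> R) (B : set Omega) : measurable B ->
  measurable_fun setT X -> {ae mu, forall w, 0 <= X w} ->
  (\int[mu]_(w in B) `|X w|%:E = \int[mu]_(w in B) (X w)%:E)%E.
Proof.
move=> mB mX X0; apply: ae_eq_integral => //.
- apply/measurable_funTS/measurable_EFinP.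
  exact: (measurableT_comp _ mX).
- by apply/measurable_funTS/measurable_EFinP.
- by apply: filterS X0 => w /= X0 _; rewrite ger0_norm.
Qed.

Lemma abs_exp_density (nu : {measure set Omega -> \bar R}) f :
  measurable_fun setT f ->
  {ae mu, forall w, 0 <= f w} ->
  (forall A, measurable A -> nu A = \int[mu]_(w in A) (f w)%:E)%E ->
  forall V, measurable_fun setT V ->
  abs_exp nu V = abs_exp mu (fun w => V w * f w).
Proof.
move=> mf f0 nuE V mV.
have mnf : measurable_fun setT (fun w => `|f w|) by exact: measurableT_comp.
rewrite /abs_exp; under [RHS]eq_integral do rewrite normrM.
transitivity (\int[nu]_w (`|V w| * 1)%:E)%E.
  by under [RHS]eq_integral do rewrite mulr1.
apply: (@integral_weight_eq _ _ _ nu mu measurable) => //.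
- exact: sigma_algebra_measurable.
- move=> B mB; rewrite integral_cst// mul1e nuE//.
  by rewrite integral_abs_ae.
- by move=> _ [B mB <-]; apply: measurableT_comp.
Qed.

End abs_exp.

Section cond_exp_ge0.
Context (R : realType) (disp : measure_display) (Omega : measurableType disp).
Context (P : {measure set Omega -> \bar R}).
Context (G : set (set Omega)) (sG : sigma_algebra setT G).
Context (Gm : G `<=` measurable).

Lemma cond_exp_weight (X Y V : Omega -> R) : is_cond_exp P G X Y ->
  {ae P, forall w, 0 <= X w} -> {ae P, forall w, 0 <= Y w} ->
  measurable_wrt G V ->
  abs_exp P (fun w => V w * X w) = abs_exp P (fun w => V w * Y w).
Proof.
move=> [iX iY mY XY] X0 Y0 mV.
have mX : measurable_fun setT X.
  by apply/measurable_EFinP; exact: measurable_int iX.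
have mYT := measurable_wrt_measurable Gm mY.
rewrite /abs_exp.
under eq_integral do rewrite normrM.
under [RHS]eq_integral do rewrite normrM.
apply: (integral_weight_eq sG Gm) => //.
- exact: measurableT_comp.
- exact: measurableT_comp.
- by move=> B GB; rewrite !integral_abs_ae ?XY//; exact: Gm.
- exact: measurable_wrt_norm.
Qed.

(** If Y were nonpositive on a non-null event of G, that event would meet A in a
    non-null set. *)
Lemma ae_gt0_of_event (A : set Omega) (Y : Omega -> R) : measurable A ->
  (forall B, G B -> P (A `&` B) = 0 -> P B = 0)%E ->
  measurable_wrt G Y -> {ae P, forall w, A w -> 0 < Y w} ->
  {ae P, forall w, 0 < Y w}.
Proof.
move=> mA AG mY AY; pose B := [set w | Y w <= 0].
have GB : G B by exact: measurable_wrt_le0.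
have mB : measurable B by exact: Gm.
exists B; split => //; last by move=> w /= /negP; rewrite -leNgt.
apply: AG => //; apply/(negligibleP _ (measurableI A B mA mB)).
by apply: negligibleS AY => w /= [Aw +] /(_ Aw); rewrite /B/= leNgt => /negP.
Qed.

(** On the event where Y is nonpositive, X * 1_A has nonpositive integral, hence
    vanishes; as X is positive, this event misses A. *)
Lemma cond_exp_gt0 (A : set Omega) (X Y : Omega -> R) : measurable A ->
  (forall B, G B -> P (A `&` B) = 0 -> P B = 0)%E ->
  is_cond_exp P G (fun w => X w * \1_A w) Y ->
  {ae P, forall w, 0 < X w} ->
  {ae P, forall w, 0 < Y w}.
Proof.
move=> mA AG [iX iY mY XY] X0; apply: (ae_gt0_of_event mA AG mY).
have mX : measurable_fun setT (fun w => X w * \1_A w).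
  by apply/measurable_EFinP; exact: measurable_int iX.
pose B := [set w | Y w <= 0].
have GB : G B by exact: measurable_wrt_le0.
have mB : measurable B by exact: Gm.
have int0 : (\int[P]_(w in B) `|(X w * \1_A w)%:E| = 0)%E.
  apply/eqP; rewrite eq_le integral_ge0// andbT.
  rewrite (integral_abs_ae mB mX); last first.
    by apply: filterS X0 => w X0; rewrite mulr_ge0// ltW.
  rewrite XY// -[leRHS](@integral0 _ _ _ P B); apply: le_integral => //.
  - exact: integrableS iY.
  - exact: integrable0.
  - by move=> w; rewrite inE /= lee_fin.
have /(ae_eq_integral_abs _ mB) : measurable_fun B
  (fun w => (X w * \1_A w)%:E) by apply/measurable_funTS/measurable_EFinP.
move=> /(_ P)[/(_ int0) + _]; apply: filterS2 X0 => w X0 XA Aw.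
rewrite ltNge; apply/negP => /XA /= -[] /eqP.
by rewrite indicE mem_set// mulr1 gt_eqF.
Qed.

End cond_exp_ge0.

(** * Events that are a fair coin toss given the past *)

Section fair_event.
Context (R : realType) (disp : measure_display) (Omega : measurableType disp).
Context (P : probability Omega R).
Context (G : set (set Omega)) (sG : sigma_algebra setT G).
Context (Gm : G `<=` measurable) (nG : P.-negligible `<=` G).

Definition fair_event (A : set Omega) : Prop := measurable A /\
  forall B, G B -> P (A `&` B) = ((2^-1)%:E * P B)%E.

Lemma negligible_complete : measure_is_complete P.
Proof. by move=> A /nG /Gm. Qed.

Lemma fair_event_null (A B : set Omega) : fair_event A -> G B ->
  (P (A `&` B) = 0 -> P B = 0)%E.
Proof.
move=> [_ AG] GB; rewrite AG// => /eqP; rewrite mule_eq0 => /orP[|/eqP//].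
by rewrite eqe invr_eq0 pnatr_eq0.
Qed.

Lemma fair_event_prob (A : set Omega) : fair_event A -> P A = (2^-1)%:E.
Proof.
move=> [_ /(_ setT)]; rewrite setIT probability_setT mule1; apply.
by have [G0 GC _] := sG; rewrite -(setD0 setT); exact: GC.
Qed.

Lemma fair_event_cond_exp (A : set Omega) : fair_event A ->
  is_cond_exp P G (\1_A) (fun=> 2^-1).
Proof.
move=> [mA AG]; split.
- exact: integrable_indic.
- exact: finite_measure_integrable_cst.
- exact: measurable_wrt_cst.
- move=> B GB; have mB := Gm GB.
  rewrite integral_cst// -AG//. exact: integral_indic.
Qed.

(** Write EA = num / den, with num and den the conditional expectations of Z 1_A
    and 1_A.  Then the weight Z / EA on A integrates like num / EA = den, which
    integrates like 1_A, that is like 1 / 2.  Positivity of num, needed to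
    cancel it, comes from A charging every non-null event of G. *)
Lemma cond_exp_on_fair (A : set Omega) (Z EA : Omega -> R) : fair_event A ->
  measurable_fun setT Z -> {ae P, forall w, 0 < Z w} ->
  is_cond_exp_on P G A Z EA ->
  [/\ measurable_wrt G EA, {ae P, forall w, 0 < EA w}
    & forall V, measurable_wrt G V ->
        abs_exp P (fun w => V w * (Z w / EA w * \1_A w)) =
        abs_exp P (fun w => V w / 2)].
Proof.
move=> fA mZ Z0 [num [den [cnum cden EAE]]].
have cP := negligible_complete.
have [mA _] := fA.
have AG B := @fair_event_null A B fA.
have num0 : {ae P, forall w, 0 < num w}.
  exact: (cond_exp_gt0 Gm mA AG cnum).
have den0 : {ae P, forall w, 0 < den w}.
  apply: (cond_exp_gt0 Gm (X := fun=> 1) mA AG); last exact: aeW.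
  by rewrite (_ : (fun w => _) = \1_A)//; apply/funext => w; rewrite mul1r.
have [_ _ mnum _] := cnum; have [_ _ mden _] := cden.
have mq := measurable_wrt_div sG mnum mden.
have EAE' : {ae P, forall w, num w / den w = EA w} by apply: filterS EAE.
have mEA : measurable_wrt G EA by exact: (measurable_wrt_ae sG nG EAE').
have EA0 : {ae P, forall w, 0 < EA w}.
  by apply: filterS3 EAE num0 den0 => w -> ? ?; exact: divr_gt0.
split=> // V mV.
have mVE : measurable_wrt G (fun w => V w / EA w) by exact: measurable_wrt_div.
have indic0 : {ae P, forall w, 0 <= (\1_A w : R)} by apply: aeW.
transitivity (abs_exp P (fun w => V w / EA w * (Z w * \1_A w))).
  by apply: eq_integral => w _; congr (`| _ |%:E); ring.
rewrite (cond_exp_weight sG Gm cnum)//; last 2 first.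
- by apply: filterS Z0 => w Z0; rewrite mulr_ge0// ltW.
- by apply: filterS num0 => w /ltW.
transitivity (abs_exp P (fun w => V w * den w)).
  apply: (abs_exp_ae cP).
    apply: (measurable_wrt_measurable Gm); exact: measurable_wrtM.
  apply: filterS3 EAE num0 den0 => w -> n0 d0.
  by field; rewrite !gt_eqF.
rewrite -(cond_exp_weight sG Gm cden)//; last by apply: filterS den0 => w /ltW.
by rewrite (cond_exp_weight sG Gm (fair_event_cond_exp fA))//; exact: aeW.
Qed.

End fair_event.

(** * The one-period density *)

Section one_period.
(* In the application [q] is the market price of risk times the square root of
   the time step, and [A], [Ac] are the two moves of the walk driving [C]. *)
Context (R : realType) (disp : measure_display) (Omega : measurableType disp).
Context (P : probability Omega R).
Context (G : set (set Omega)) (sG : sigma_algebra setT G).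
Context (Gm : G `<=` measurable) (nG : P.-negligible `<=` G).
Context (A Ac : set Omega) (fA : fair_event P G A) (fAc : fair_event P G Ac).
Context (AAc : A `&` Ac = set0).
Context (Z EA EAc q Lam : Omega -> R).
Context (mZ : measurable_fun setT Z) (Z0 : {ae P, forall w, 0 < Z w}).
Context (cA : is_cond_exp_on P G A Z EA) (cAc : is_cond_exp_on P G Ac Z EAc).
Context (mq : measurable_wrt G q) (q1 : {ae P, forall w, `|q w| < 1}).
Context (LamA : {ae P, forall w, A w -> Lam w = (1 - q w) * (Z w / EA w)}).
Context (LamAc : {ae P, forall w, Ac w -> Lam w = (1 + q w) * (Z w / EAc w)}).

Lemma ae_fair_cover : {ae P, forall w, A w \/ Ac w}.
Proof.
have [mA _] := fA; have [mAc _] := fAc.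
have mU := measurableU _ _ mA mAc.
suff : P.-negligible (~` (A `|` Ac)) by [].
apply/negligibleP; first exact: measurableC.
apply: (etrans (probability_setC P mU)); rewrite measureU//.
transitivity (1 - ((2^-1 : R)%:E + (2^-1 : R)%:E))%E.
  by congr (1 - (_ + _))%E; exact: (fair_event_prob sG).
by have e : 1 - (2^-1 + 2^-1) = 0 :> R; [field|exact: (congr1 EFin e)].
Qed.

Lemma fair_density_gt0 : {ae P, forall w, 0 < Lam w}.
Proof.
have [_ EA0 _] := cond_exp_on_fair sG Gm nG fA mZ Z0 cA.
have [_ EAc0 _] := cond_exp_on_fair sG Gm nG fAc mZ Z0 cAc.
near=> w.
have Zw : 0 < Z w by near: w.
have qw : `|q w| < 1 by near: w.
have EAw : 0 < EA w by near: w.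
have EAcw : 0 < EAc w by near: w.
have LA : A w -> Lam w = (1 - q w) * (Z w / EA w) by near: w.
have LAc : Ac w -> Lam w = (1 + q w) * (Z w / EAc w) by near: w.
have : A w \/ Ac w by near: w; exact: ae_fair_cover.
move: qw; rewrite ltr_norml => /andP[q1' q1''].
by move=> [/LA|/LAc] ->; rewrite mulr_gt0 ?divr_gt0//; lra.
Unshelve. all: by end_near. Qed.

(** As A and Ac cover almost everything, the two branches can be glued into one
    formula, from which the measurability of the density can be read off. *)
Lemma fair_densityE : {ae P, forall w,
  (1 - q w) * (Z w / EA w * \1_A w) + (1 + q w) * (Z w / EAc w * \1_Ac w) =
  Lam w}.
Proof.
near=> w.
have LA : A w -> Lam w = (1 - q w) * (Z w / EA w) by near: w.
have LAc : Ac w -> Lam w = (1 + q w) * (Z w / EAc w) by near: w.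
have : A w \/ Ac w by near: w; exact: ae_fair_cover.
rewrite !indicE; move=> [Aw|Acw].
  have nAc : ~ Ac w by move=> Acw; have : (A `&` Ac) w by []; rewrite AAc.
  by rewrite (LA Aw) mem_set// memNset// mulr0 mulr1 mulr0 addr0.
have nA : ~ A w by move=> Aw; have : (A `&` Ac) w by []; rewrite AAc.
by rewrite (LAc Acw) memNset// mem_set// mulr0 mulr1 mulr0 add0r.
Unshelve. all: by end_near. Qed.

Lemma fair_density_measurable (H : set (set Omega)) : sigma_algebra setT H ->
  G `<=` H -> H A -> H Ac -> measurable_wrt H Z -> measurable_wrt H Lam.
Proof.
move=> sH GH HA HAc mZH.
have [mEA _ _] := cond_exp_on_fair sG Gm nG fA mZ Z0 cA.
have [mEAc _ _] := cond_exp_on_fair sG Gm nG fAc mZ Z0 cAc.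
have nH : P.-negligible `<=` H by move=> B /nG /GH.
apply: (measurable_wrt_ae sH nH fair_densityE).
have mqH := measurable_wrtS GH mq.
have m1 : measurable_wrt H (fun=> 1 : R) by exact: measurable_wrt_cst.
apply: measurable_wrtD => //; apply: measurable_wrtM => //.
- exact: measurable_wrtB.
- apply: measurable_wrtM => //; last exact: measurable_wrt_indic.
  by apply: measurable_wrt_div => //; exact: measurable_wrtS mEA.
- exact: measurable_wrtD.
- apply: measurable_wrtM => //; last exact: measurable_wrt_indic.
  by apply: measurable_wrt_div => //; exact: measurable_wrtS mEAc.
Qed.

(** The factors Z / EA and Z / EAc integrate like 1 / 2 against everything known
    in G, so the tilted measure gives the two moves the conditional masses
    (1 - q) / 2 and (1 + q) / 2. *)
Lemma fair_density_split (V W X : Omega -> R) :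
  measurable_wrt G V -> measurable_wrt G W ->
  {ae P, forall w, A w -> X w = V w} -> {ae P, forall w, Ac w -> X w = W w} ->
  abs_exp P (fun w => X w * Lam w) =
  abs_exp P (fun w => `|V w| * ((1 - q w) / 2) + `|W w| * ((1 + q w) / 2)).
Proof.
move=> mV mW XV XW.
have cP := negligible_complete Gm nG.
have [mA _] := fA; have [mAc _] := fAc.
have [mEA _ intA] := cond_exp_on_fair sG Gm nG fA mZ Z0 cA.
have [mEAc _ intAc] := cond_exp_on_fair sG Gm nG fAc mZ Z0 cAc.
have m1 : measurable_wrt G (fun=> 1 : R) by exact: measurable_wrt_cst.
have m2 : measurable_wrt G (fun=> 2^-1 : R) by exact: measurable_wrt_cst.
have mVq : measurable_wrt G (fun w => V w * (1 - q w)).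
  by apply: measurable_wrtM => //; exact: measurable_wrtB.
have mWq : measurable_wrt G (fun w => W w * (1 + q w)).
  by apply: measurable_wrtM => //; exact: measurable_wrtD.
have toT (Y : Omega -> R) (mY : measurable_wrt G Y) : measurable_fun setT Y.
  exact: measurable_wrt_measurable mY.
pose f w := V w * (1 - q w) * (Z w / EA w * \1_A w).
pose g w := W w * (1 + q w) * (Z w / EAc w * \1_Ac w).
have mf : measurable_fun setT f.
  apply: measurable_realfun.measurable_funM; first exact: toT.
  apply: measurable_realfun.measurable_funM; last exact: measurable_indic.
  apply: measurable_realfun.measurable_funM => //.
  by apply: toT; exact: measurable_wrt_inv.
have mg : measurable_fun setT g.
  apply: measurable_realfun.measurable_funM; first exact: toT.
  apply: measurable_realfun.measurable_funM; last exact: measurable_indic.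
  apply: measurable_realfun.measurable_funM => //.
  by apply: toT; exact: measurable_wrt_inv.
have fg0 w : f w = 0 \/ g w = 0.
  have [Aw|nA] := pselect (A w).
    right; rewrite /g indicE memNset ?mulr0// => Acw.
    by have : (A `&` Ac) w by []; rewrite AAc.
  by left; rewrite /f indicE memNset ?mulr0.
transitivity (abs_exp P (fun w => f w + g w)).
  apply/esym/(abs_exp_ae cP); first exact: measurable_realfun.measurable_funD.
  near=> w.
  have LE : (1 - q w) * (Z w / EA w * \1_A w) +
    (1 + q w) * (Z w / EAc w * \1_Ac w) = Lam w.
    by near: w; exact: fair_densityE.
  have XVw : A w -> X w = V w by near: w.
  have XWw : Ac w -> X w = W w by near: w.
  rewrite -LE mulrDr /f /g; congr (_ + _).
    have [Aw|nA] := pselect (A w); first by rewrite XVw//; ring.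
    by rewrite indicE memNset// !mulr0.
  have [Aw|nA] := pselect (Ac w); first by rewrite XWw//; ring.
  by rewrite indicE memNset// !mulr0.
rewrite abs_expD//; last first.
  by apply: aeW => w; case: (fg0 w) => ->; rewrite normr0 ?add0r ?addr0.
rewrite intA// intAc// abs_expD//; first last.
- apply: filterS q1 => w; rewrite ltr_norml => /andP[? ?].
  have V0 : 0 <= `|V w| * ((1 - q w) / 2) by rewrite mulr_ge0//; lra.
  have W0 : 0 <= `|W w| * ((1 + q w) / 2) by rewrite mulr_ge0//; lra.
  by rewrite (ger0_norm (addr_ge0 V0 W0)) (ger0_norm V0) (ger0_norm W0).
- apply: toT; apply: measurable_wrtM => //; first exact: measurable_wrt_norm.
  by apply: measurable_wrtM => //; exact: measurable_wrtD.
- apply: toT; apply: measurable_wrtM => //; first exact: measurable_wrt_norm.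
  by apply: measurable_wrtM => //; exact: measurable_wrtB.
by congr (_ + _)%E; apply: eq_integral => w _; congr (_%:E);
  rewrite !normrM normr_id mulrA.
Unshelve. all: by end_near. Qed.

(** The two masses add up to 1. *)
Lemma fair_density_martingale (V : Omega -> R) : measurable_wrt G V ->
  abs_exp P (fun w => V w * Lam w) = abs_exp P V.
Proof.
move=> mV; rewrite (fair_density_split mV mV); [|by apply: aeW..].
apply: eq_integral => w _; congr (_%:E).
by rewrite -[RHS]normr_id; congr (`| _ |); field.
Qed.

(** [m] is the drift and [s] the size of the random part of the return.  The
    tilted mean of the gross return is
    (1 + m + s) (1 - q) / 2 + (1 + m - s) (1 + q) / 2 = 1 + m - q s = 1.
    The two gross returns are G-measurable and positive on A and Ac
    respectively, hence positive almost everywhere, which lets the absolute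
    values be dropped. *)
Lemma fair_density_asset (C C' m s V : Omega -> R) :
  measurable_wrt G C -> measurable_wrt G m -> measurable_wrt G s ->
  {ae P, forall w, 0 < C w} -> {ae P, forall w, 0 < C' w} ->
  {ae P, forall w, A w -> C' w = C w * (1 + m w + s w)} ->
  {ae P, forall w, Ac w -> C' w = C w * (1 + m w - s w)} ->
  {ae P, forall w, m w = q w * s w} ->
  measurable_wrt G V ->
  abs_exp P (fun w => V w * C' w * Lam w) = abs_exp P (fun w => V w * C w).
Proof.
move=> mC mm ms C0 C'0 CA CAc mqs mV.
have cP := negligible_complete Gm nG.
have m1 : measurable_wrt G (fun=> 1 : R) by exact: measurable_wrt_cst.
have m1m : measurable_wrt G (fun w => 1 + m w) by exact: measurable_wrtD.
have mu : measurable_wrt G (fun w => 1 + m w + s w) by exact: measurable_wrtD.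
have mv : measurable_wrt G (fun w => 1 + m w - s w) by exact: measurable_wrtB.
have mVC : measurable_wrt G (fun w => V w * C w) by exact: measurable_wrtM.
have [mA _] := fA; have [mAc _] := fAc.
have u0 : {ae P, forall w, 0 < 1 + m w + s w}.
  apply: (ae_gt0_of_event Gm mA _ mu).
    by move=> B; exact: (fair_event_null fA).
  apply: filterS3 C0 C'0 CA => w Cw C'w CAw Aw.
  by move: C'w; rewrite CAw// pmulr_rgt0.
have v0 : {ae P, forall w, 0 < 1 + m w - s w}.
  apply: (ae_gt0_of_event Gm mAc _ mv).
    by move=> B; exact: (fair_event_null fAc).
  apply: filterS3 C0 C'0 CAc => w Cw C'w CAw Aw.
  by move: C'w; rewrite CAw// pmulr_rgt0.
rewrite (fair_density_split (V := fun w => V w * C w * (1 + m w + s w))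
  (W := fun w => V w * C w * (1 + m w - s w))); first last.
- by apply: filterS CAc => w e Aw; rewrite e//; ring.
- by apply: filterS CA => w e Aw; rewrite e//; ring.
- exact: measurable_wrtM.
- exact: measurable_wrtM.
transitivity (abs_exp P (fun w => `|V w * C w|)); last first.
  by apply: eq_integral => w _; rewrite normr_id.
apply/esym/(abs_exp_ae cP).
  apply: (measurable_wrt_measurable Gm).
  exact: measurable_wrt_norm.
apply: filterS3 mqs u0 v0 => w e u v.
rewrite (normrM _ (1 + m w + s w)) (normrM _ (1 + m w - s w)).
by rewrite (gtr0_norm u) (gtr0_norm v) e; field.
Qed.

End one_period.

(** * From one period to the pricing measure *)

Lemma martingale_of_steps (R : realType) (disp : measure_display)
  (Omega : measurableType disp) (mu : {measure set Omega -> \bar R})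
  (N : nat) (F : nat -> set (set Omega)) (M : nat -> Omega -> R) :
  (forall m n, (m <= n <= N)%N -> F m `<=` F n) ->
  adapted N F M ->
  (forall n, (n <= N)%N -> mu.-integrable setT (EFin \o M n)) ->
  (forall k, (k < N)%N -> is_cond_exp mu (F k) (M k.+1) (M k)) ->
  martingale mu N F M.
Proof.
move=> FS aM iM sM; split=> // m n /andP[mn nN].
elim: n mn nN => [|n IH] mn nN.
  move: mn; rewrite leqn0 => /eqP ->.
  by split => //; [exact: iM|exact: iM|exact: aM].
move: mn; rewrite leq_eqVlt => /orP[/eqP ->|].
  by split => //; [exact: iM|exact: iM|exact: aM].
rewrite ltnS => mn; have [_ iMm mMm IHE] := IH mn (ltnW nN).
have [iMn1 _ _ sE] := sM _ nN; split => // A FA.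
by rewrite sE ?IHE//; apply: (FS m n) => //; rewrite mn ltnW.
Qed.

Lemma is_cond_exp_of_abs_exp (R : realType) (disp : measure_display)
  (Omega : measurableType disp) (mu : {measure set Omega -> \bar R})
  (G : set (set Omega)) (X Y : Omega -> R) : sigma_algebra setT G ->
  G `<=` measurable ->
  mu.-integrable setT (EFin \o X) -> mu.-integrable setT (EFin \o Y) ->
  measurable_wrt G Y ->
  {ae mu, forall w, 0 <= X w} -> {ae mu, forall w, 0 <= Y w} ->
  (forall V, measurable_wrt G V ->
    abs_exp mu (fun w => V w * X w) = abs_exp mu (fun w => V w * Y w)) ->
  is_cond_exp mu G X Y.
Proof.
move=> sG Gm iX iY mY X0 Y0 XY; split => // A GA; have mA := Gm _ GA.
have toA (W : Omega -> R) : mu.-integrable setT (EFin \o W) ->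
    {ae mu, forall w, 0 <= W w} ->
    (\int[mu]_(w in A) (W w)%:E = abs_exp mu (fun w => \1_A w * W w)%R)%E.
  move=> iW W0; rewrite -integral_abs_ae//.
    rewrite integral_mkcond; apply: eq_integral => w _.
    rewrite patchE indicE; case: ifPn => _; last by rewrite mul0r normr0.
    by rewrite mul1r.
  by apply/measurable_EFinP; exact: measurable_int iW.
by rewrite !toA//; apply: XY; exact: measurable_wrt_indic.
Qed.

Section density_process.
Context (R : realType) (disp : measure_display) (Omega : measurableType disp).
Context (P : probability Omega R) (N : nat) (F : nat -> set (set Omega)).
Context (hF : complete_filtration P N F).
Context (Lam : nat -> Omega -> R).
Context (mLam : forall k, (k < N)%N -> measurable_wrt (F k.+1) (Lam k.+1)).
Context (Lam0 : forall k, (k < N)%N -> {ae P, forall w, 0 < Lam k.+1 w}).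
Context (ELam : forall k V, (k < N)%N -> measurable_wrt (F k) V ->
  abs_exp P (fun w => V w * Lam k.+1 w) = abs_exp P V).
Context (Q : {measure set Omega -> \bar R}).
Context (hQ : forall A, measurable A ->
  Q A = (\int[P]_(w in A) (\prod_(1 <= n < N.+1) Lam n w)%:E)%E).

Let L k w := \prod_(1 <= n < k.+1) Lam n w.

Lemma density_processS k w : L k.+1 w = L k w * Lam k.+1 w.
Proof. by rewrite /L big_nat_recr. Qed.

Lemma density_process_measurable k : (k <= N)%N -> measurable_wrt (F k) (L k).
Proof.
have [sF _ FS _] := hF.
elim: k => [|k IH] kN.
  rewrite (_ : L 0 = fun=> 1); first exact: measurable_wrt_cst (sF _ kN) _.
  by apply/funext => w; rewrite /L big_geq.
rewrite (_ : L k.+1 = fun w => L k w * Lam k.+1 w); last first.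
  by apply/funext => w; exact: density_processS.
apply: (measurable_wrtM (sF _ kN)); last exact: mLam.
by apply: measurable_wrtS (IH (ltnW kN)); apply: FS; rewrite leqnSn.
Qed.

Lemma density_process_gt0 k : (k <= N)%N -> {ae P, forall w, 0 < L k w}.
Proof.
elim: k => [|k IH] kN; first by apply: aeW => w; rewrite /L big_geq.
apply: filterS2 (IH (ltnW kN)) (Lam0 kN) => w Lw Lamw.
by rewrite density_processS mulr_gt0.
Qed.

Lemma density_process_dominated (A : set Omega) : measurable A ->
  P A = 0%E -> Q A = 0%E.
Proof.
have [sF mF FS _] := hF.
move=> mA PA; rewrite hQ// -[RHS](@integral0 _ _ _ P A).
apply: ae_eq_integral => //; last by exact: ae_eq0.
apply/measurable_funTS/measurable_EFinP.
exact: (measurable_wrt_measurable (mF _ (leqnn N))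
  (density_process_measurable (leqnn N))).
Qed.

Lemma density_process_ae (E : Omega -> Prop) :
  {ae P, forall w, E w} -> {ae Q, forall w, E w}.
Proof.
move=> [A [mA PA EA]]; exists A; split => //.
exact: density_process_dominated.
Qed.

(** Backward induction on k: the density of the last period integrates to 1
    against anything known before it. *)
Lemma abs_exp_change_of_measure k V : (k <= N)%N -> measurable_wrt (F k) V ->
  abs_exp Q V = abs_exp P (fun w => V w * L k w).
Proof.
have [sF mF FS _] := hF.
move=> kN; rewrite -(subKn kN); move: (N - k)%N (leq_subr k N).
elim=> [|j IH] jN.
  rewrite subn0 => mV; apply: abs_exp_density hQ _ _.
  - exact: measurable_wrt_measurable (mF _ (leqnn N))
      (density_process_measurable (leqnn N)).
  - by apply: filterS (density_process_gt0 (leqnn N)) => w /ltW.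
  - exact: measurable_wrt_measurable (mF _ (leqnn N)) mV.
(* [i] is the time step being removed: [N - j = i.+1]. *)
have := IH (ltnW jN); rewrite -(subnSK jN); set i := (N - j.+1)%N => IHi mV.
have iN : (i < N)%N by rewrite /i ltn_subrL (leq_trans _ jN).
rewrite IHi; last by apply: measurable_wrtS mV; apply: FS; rewrite leqnSn.
rewrite -(ELam (V := fun w => V w * L i w) iN); last first.
  apply: (measurable_wrtM (sF _ (ltnW iN))) => //.
  exact: density_process_measurable (ltnW iN).
by apply: eq_integral => w _; rewrite density_processS mulrA.
Qed.

(** The one-period identity [Cstep], used with the weight V times the density up
    to time k, says that the steps of C are fair under Q.  The weight 1 gives
    the same Q-integral to all C n, namely c, whence integrability; indicators
    as weights give the conditional expectations. *)
Lemma density_process_martingale (C : nat -> Omega -> R) (c : R) :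
  adapted N F C ->
  {ae P, forall w, C 0%N w = c} ->
  (forall n, (n <= N)%N -> {ae P, forall w, 0 < C n w}) ->
  (forall k V, (k < N)%N -> measurable_wrt (F k) V ->
    abs_exp P (fun w => V w * C k.+1 w * Lam k.+1 w) =
    abs_exp P (fun w => V w * C k w)) ->
  martingale Q N F C.
Proof.
have [sF mF FS nF] := hF.
move=> aC C0 Cpos Cstep.
have step k V : (k < N)%N -> measurable_wrt (F k) V ->
    abs_exp Q (fun w => V w * C k.+1 w) = abs_exp Q (fun w => V w * C k w).
  move=> kN mV; have kN' := ltnW kN.
  have FkS : F k `<=` F k.+1 by apply: FS; rewrite leqnSn.
  have mVC1 : measurable_wrt (F k.+1) (fun w => V w * C k.+1 w).
    by apply: (measurable_wrtM (sF _ kN)); [exact: measurable_wrtS mV|exact: aC].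
  have mVC : measurable_wrt (F k) (fun w => V w * C k w).
    by apply: (measurable_wrtM (sF _ kN')) => //; exact: aC.
  have mL := density_process_measurable kN'.
  rewrite (abs_exp_change_of_measure kN mVC1) (abs_exp_change_of_measure kN' mVC).
  transitivity (abs_exp P (fun w => V w * L k w * C k.+1 w * Lam k.+1 w)).
    apply: eq_integral => w _; rewrite density_processS; congr (`| _ |%:E).
    by ring.
  rewrite (Cstep k (fun w => V w * L k w))//; last first.
    exact: (measurable_wrtM (sF _ kN')).
  by apply: eq_integral => w _; congr (`| _ |%:E); ring.
have mC n : (n <= N)%N -> measurable_fun setT (C n).
  by move=> nN; exact: measurable_wrt_measurable (mF _ nN) (aC _ nN).
have EC n : (n <= N)%N -> abs_exp Q (C n) = `|c|%:E.
  elim: n => [|n IH] nN.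
    rewrite (abs_exp_change_of_measure nN (aC _ nN)).
    rewrite (_ : (fun w => _) = C 0%N); last first.
      by apply/funext => w; rewrite /L big_geq// mulr1.
    rewrite (abs_exp_ae _ (mC _ nN) C0); last by move=> A /nF /(mF _ nN).
    rewrite /abs_exp integral_cst//; transitivity (`|c|%:E * 1)%E.
      by congr (_ * _)%E; exact: probability_setT.
    by rewrite mule1.
  have one j : abs_exp Q (C j) = abs_exp Q (fun w => 1 * C j w).
    by apply: eq_integral => w _; rewrite mul1r.
  rewrite -(IH (ltnW nN)) !one; apply: (step n (fun=> 1)) => //.
  exact: measurable_wrt_cst (sF _ (ltnW nN)) _.
have iC n : (n <= N)%N -> Q.-integrable setT (EFin \o C n).
  move=> nN; apply/integrableP; split; first by apply/measurable_EFinP/mC.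
  by have := EC n nN; rewrite /abs_exp /= => ->; rewrite ltry.
have C0Q n : (n <= N)%N -> {ae Q, forall w, 0 <= C n w}.
  move=> nN; apply: density_process_ae.
  by apply: filterS (Cpos _ nN) => w /ltW.
apply: martingale_of_steps => // k kN; have kN' := ltnW kN.
apply: is_cond_exp_of_abs_exp;
  [exact: sF|exact: mF|exact: iC|exact: iC|exact: aC|exact: C0Q|exact: C0Q|].
by move=> V; exact: step.
Qed.

End density_process.

(** * The equilibrium market *)

Lemma binomial_fair_event (R : realType) (disp : measure_display)
  (Omega : measurableType disp) (P : probability Omega R)
  (N : nat) (F : nat -> set (set Omega)) (dim : nat)
  (b : 'I_dim -> nat -> Omega -> R) (i : 'I_dim) (k : nat) (x : R) :
  complete_filtration P N F -> binomial_random_walk P N F b -> (k < N)%N ->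
  x = 1 \/ x = -1 ->
  F k.+1 [set w | incr (b i) k w = x] /\
  fair_event P (F k) [set w | incr (b i) k w = x].
Proof.
move=> [sF mF FS _] [ab pb ib] kN x1.
have FA : F k.+1 [set w | incr (b i) k w = x].
  apply: measurable_wrt_set1; apply: (measurable_wrtB (sF _ kN)).
    exact: ab.
  by apply: measurable_wrtS (ab i k (ltnW kN)); apply: FS; rewrite leqnSn.
split=> //; split; first exact: mF FA.
move=> B FB; rewrite (ib k kN)//.
  by congr (_ * _)%E; have [? ?] := pb i k kN; case: x1 => ->.
apply: sub_sigma_algebra; exists i => //; exists [set x] => //.
by rewrite setTI.
Qed.

Theorem lemma3p4 (R : realType)
  (* time grid *)
  (T h : R) (N : nat) (hT : 0 < T) (hN : (0 < N)%N) (hh : h = T / N%:R)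
  (* filtered probability space and noise *)
  (disp : measure_display) (Omega : measurableType disp)
  (P : probability Omega R) (F : nat -> set (set Omega))
  (hF : complete_filtration P N F)
  (dim : nat) (hdim : (1 < dim)%N) (b : 'I_dim -> nat -> Omega -> R)
  (hb : binomial_random_walk P N F b)
  (b1 b2 : nat -> Omega -> R)
  (hb1 : b1 = b (Ordinal (ltnW hdim))) (hb2 : b2 = b (Ordinal hdim))
  (* primary traded asset *)
  (muc sigmac C : nat -> Omega -> R) (c : R) (hc : 0 < c)
  (hmuc : adapted N F muc) (hsigmac : adapted N F sigmac)
  (hC0 : {ae P, forall w, C 0%N w = c})
  (hC : forall n, (n < N)%N -> {ae P, forall w, incr C n w =
      C n w * (muc n w * h + sigmac n w * Num.sqrt h * incr b1 n w)})
  (hCpos : forall n, (n <= N)%N -> {ae P, forall w, 0 < C n w})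
  (* non-traded asset *)
  (mus sigmas S : nat -> Omega -> R) (s rho : R) (hs : 0 < s)
  (hrho : `|rho| < 1)
  (hmus : adapted N F mus) (hsigmas : adapted N F sigmas)
  (hS0 : {ae P, forall w, S 0%N w = s})
  (hS : forall n, (n < N)%N -> {ae P, forall w, incr S n w =
      S n w * (mus n w * h + sigmas n w * Num.sqrt h *
        (rho * incr b1 n w + Num.sqrt (1 - rho ^+ 2) * incr b2 n w))})
  (* market price of risk *)
  (r : nat -> Omega -> R)
  (hr : forall n, (n < N)%N -> {ae P, forall w, r n w = muc n w / sigmac n w})
  (hrpos : forall n, (n < N)%N -> {ae P, forall w, 0 < r n w})
  (hrsmall : forall n, (n < N)%N -> {ae P, forall w, r n w * Num.sqrt h < 1})
  (* derivative security, dividend, agent *)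
  (D : nat -> Omega -> R) (hDN : measurable_wrt (F N) (D N))
  (phi : R -> R -> R -> R)
  (gamma : nat -> Omega -> R) (hgamma : adapted N F gamma)
  (hgammapos : forall n, (n < N)%N -> {ae P, forall w, 0 < gamma n w})
  (Inc : Omega -> R) (hInc : measurable_wrt (F N) Inc)
  (* equilibrium recursion: gains increments dX, certainty equivalents Y,
     positions alpha; EA, EAc are the expectations conditional on A, A^c *)
  (dX Y alpha Z EA EAc : nat -> Omega -> R)
  (hY : forall k, (k < N)%N ->
     is_cond_exp P (F k.+1)
       (fun w => expR (- gamma k w * (\sum_(k.+1 <= j < N) dX j w + Inc w)))
       (fun w => expR (- gamma k w * Y k.+1 w)))
  (hdX : forall j, (j < N)%N -> {ae P, forall w, dX j w =
      alpha j w * (muc j w * h + Num.sqrt h * sigmac j w * incr b1 j w)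
      + incr D j w + phi (j%:R * h) (C j w) (S j w) * h})
  (hZ : forall k, (k < N)%N -> {ae P, forall w,
      Z k w = expR (- gamma k w * (D k.+1 w + Y k.+1 w))})
  (hEA : forall k, (k < N)%N ->
     is_cond_exp_on P (F k) [set w | incr b1 k w = 1] (Z k) (EA k))
  (hEAc : forall k, (k < N)%N ->
     is_cond_exp_on P (F k) [set w | incr b1 k w = -1] (Z k) (EAc k))
  (halpha : forall k, (k < N)%N -> {ae P, forall w, alpha k w =
      1 / (2 * gamma k w * sigmac k w * Num.sqrt h)
        * ln ((1 + r k w * Num.sqrt h) / (1 - r k w * Num.sqrt h))
      + 1 / (2 * gamma k w * sigmac k w * Num.sqrt h)
        * ln (EA k w / EAc k w)})
  (* one-step densities and pricing measure *)
  (Lambda : nat -> Omega -> R)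
  (hLambdaA : forall k, (k < N)%N -> {ae P, forall w, incr b1 k w = 1 ->
      Lambda k.+1 w = (1 - r k w * Num.sqrt h) * (Z k w / EA k w)})
  (hLambdaAc : forall k, (k < N)%N -> {ae P, forall w, incr b1 k w = -1 ->
      Lambda k.+1 w = (1 + r k w * Num.sqrt h) * (Z k w / EAc k w)})
  (Q : {measure set Omega -> \bar R})
  (hQ : forall A, measurable A ->
      Q A = (\int[P]_(w in A) (\prod_(1 <= n < N.+1) Lambda n w)%:E)%E)
  (* equilibrium price *)
  (hD : forall k, (k < N)%N ->
     is_cond_exp Q (F k)
       (fun w => D k.+1 w + phi (k%:R * h) (C k w) (S k w) * h) (D k))
  (* no dividend *)
  (hphi : forall t x y, phi t x y = 0) :
  martingale Q N F C /\ martingale Q N F D.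
Proof.
have h0 : 0 < h by rewrite hh divr_gt0// ltr0n.
have sqrth0 : 0 < Num.sqrt h by rewrite sqrtr_gt0.
have [sF mF FS nF0] := hF.
have nF k : (k <= N)%N -> P.-negligible `<=` F k.
  by move=> kN; apply: subset_trans nF0 (FS _ _ _).
have FkS k : (k < N)%N -> F k `<=` F k.+1.
  by move=> kN; apply: FS; rewrite leqnSn.
pose A k := [set w | incr b1 k w = 1].
pose Ac k := [set w | incr b1 k w = -1].
have evA k : (k < N)%N -> F k.+1 (A k) /\ fair_event P (F k) (A k).
  by move=> kN; rewrite /A hb1; apply: binomial_fair_event hF hb kN _; left.
have evAc k : (k < N)%N -> F k.+1 (Ac k) /\ fair_event P (F k) (Ac k).
  by move=> kN; rewrite /Ac hb1; apply: binomial_fair_event hF hb kN _; right.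
have AAc k : A k `&` Ac k = set0.
  by rewrite -subset0 => w []; rewrite /A /Ac /= => -> ?; lra.
have mb1 k : (k < N)%N -> measurable_wrt (F k.+1) (incr b1 k).
  move=> kN; have [ab _ _] := hb; rewrite hb1.
  apply: (measurable_wrtB (sF _ kN)); first exact: ab.
  exact: measurable_wrtS (FkS _ kN) (ab _ _ (ltnW kN)).
have cst k x : (k <= N)%N -> measurable_wrt (F k) (fun=> x : R).
  by move=> kN; exact: measurable_wrt_cst (sF _ kN) _.
(* [m k] and [s' k] are the drift and the size of the random part of the return
   of [C]; the definition of the market price of risk becomes [m = q * s'],
   where positivity of [r] excludes a vanishing volatility. *)
pose q k w := r k w * Num.sqrt h.
pose m k w := muc k w * h.
pose s' k w := sigmac k w * Num.sqrt h.
have mm k : (k < N)%N -> measurable_wrt (F k) (m k).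
  move=> /ltnW kN; apply: (measurable_wrtM (sF _ kN)); first exact: hmuc.
  exact: cst.
have ms k : (k < N)%N -> measurable_wrt (F k) (s' k).
  move=> /ltnW kN; apply: (measurable_wrtM (sF _ kN)); first exact: hsigmac.
  exact: cst.
have mq k : (k < N)%N -> measurable_wrt (F k) (q k).
  move=> kN; have kN' := ltnW kN.
  apply: (measurable_wrt_ae (sF _ kN') (nF _ kN')
    (X := fun w => muc k w / sigmac k w * Num.sqrt h)).
    by apply: filterS (hr _ kN) => w rE; rewrite /q rE.
  apply: (measurable_wrtM (sF _ kN')); last exact: cst.
  by apply: (measurable_wrt_div (sF _ kN')); [exact: hmuc|exact: hsigmac].
have q1 k : (k < N)%N -> {ae P, forall w, `|q k w| < 1}.
  move=> kN; apply: filterS2 (hrpos _ kN) (hrsmall _ kN) => w r0 r1.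
  by rewrite ger0_norm// mulr_ge0// ltW.
have mqs k : (k < N)%N -> {ae P, forall w, m k w = q k w * s' k w}.
  move=> kN; apply: filterS2 (hr _ kN) (hrpos _ kN) => w rE r0.
  have sig0 : sigmac k w != 0.
    by apply: contraTneq r0 => sig0; rewrite rE sig0 invr0 mulr0 ltxx.
  rewrite /m /q /s' rE.
  rewrite (_ : _ * _ * _ = muc k w * (Num.sqrt h * Num.sqrt h)).
    by rewrite -expr2 sqr_sqrtr// ltW.
  by field.
have mD k : (k <= N)%N -> measurable_wrt (F k) (D k).
  rewrite leq_eqVlt => /orP[/eqP ->//|kN].
  by have [] := hD _ kN.
have mZ k : (k < N)%N -> measurable_wrt (F k.+1) (Z k).
  move=> kN; apply: (measurable_wrt_ae (sF _ kN) (nF _ kN)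
    (X := fun w => expR (- gamma k w * D k.+1 w) *
      expR (- gamma k w * Y k.+1 w))).
    by apply: filterS (hZ _ kN) => w ->; rewrite -expRD mulrDr.
  apply: (measurable_wrtM (sF _ kN)); last by have [] := hY _ kN.
  apply: (measurable_wrt_exp (sF _ kN)).
  apply: (measurable_wrtM (sF _ kN)); last exact: mD.
  apply: (measurable_wrtN (sF _ kN)).
  exact: measurable_wrtS (FkS _ kN) (hgamma _ (ltnW kN)).
have mZT k (kN : (k < N)%N) := measurable_wrt_measurable (mF _ kN) (mZ _ kN).
have Z0 k : (k < N)%N -> {ae P, forall w, 0 < Z k w}.
  by move=> kN; apply: filterS (hZ _ kN) => w ->; exact: expR_gt0.
have CS k : (k < N)%N -> {ae P, forall w,
    C k.+1 w = C k w * (1 + m k w + s' k w * incr b1 k w)}.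
  move=> kN; apply: filterS (hC _ kN) => w /eqP.
  by rewrite {1}/incr subr_eq => /eqP ->; rewrite /m /s'; ring.
have mC : adapted N F C.
  elim=> [|n IH] nN.
    apply: (measurable_wrt_ae (sF _ nN) (nF _ nN) (X := fun=> c)).
      by apply: filterS hC0.
    exact: cst.
  apply: (measurable_wrt_ae (sF _ nN) (nF _ nN)
    (X := fun w => C n w * (1 + m n w + s' n w * incr b1 n w))).
    by apply: filterS (CS _ nN).
  have up X (mX : measurable_wrt (F n) X) := measurable_wrtS (FkS _ nN) mX.
  apply: (measurable_wrtM (sF _ nN)); first exact: up _ (IH (ltnW nN)).
  apply: (measurable_wrtD (sF _ nN)).
    by apply: (measurable_wrtD (sF _ nN)); [exact: cst|exact: up _ (mm _ nN)].
  by apply: (measurable_wrtM (sF _ nN)); [exact: up _ (ms _ nN)|exact: mb1].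
have mLam k : (k < N)%N -> measurable_wrt (F k.+1) (Lambda k.+1).
  move=> kN; have kN' := ltnW kN.
  have [FA fA] := evA _ kN; have [FAc fAc] := evAc _ kN.
  exact: (fair_density_measurable (sF _ kN') (mF _ kN') (nF _ kN') fA fAc
    (AAc k) (mZT _ kN) (Z0 _ kN) (hEA _ kN) (hEAc _ kN) (mq _ kN)
    (hLambdaA _ kN) (hLambdaAc _ kN) (sF _ kN) (FkS _ kN) FA FAc (mZ _ kN)).
have Lam0 k : (k < N)%N -> {ae P, forall w, 0 < Lambda k.+1 w}.
  move=> kN; have kN' := ltnW kN.
  have [_ fA] := evA _ kN; have [_ fAc] := evAc _ kN.
  exact: (fair_density_gt0 (sF _ kN') (mF _ kN') (nF _ kN') fA fAc
    (AAc k) (mZT _ kN) (Z0 _ kN) (hEA _ kN) (hEAc _ kN) (q1 _ kN)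
    (hLambdaA _ kN) (hLambdaAc _ kN)).
have ELam k V : (k < N)%N -> measurable_wrt (F k) V ->
    abs_exp P (fun w => V w * Lambda k.+1 w) = abs_exp P V.
  move=> kN; have kN' := ltnW kN.
  have [_ fA] := evA _ kN; have [_ fAc] := evAc _ kN.
  exact: (fair_density_martingale (sF _ kN') (mF _ kN') (nF _ kN') fA fAc
    (AAc k) (mZT _ kN) (Z0 _ kN) (hEA _ kN) (hEAc _ kN) (mq _ kN) (q1 _ kN)
    (hLambdaA _ kN) (hLambdaAc _ kN)).
have ELamC k V : (k < N)%N -> measurable_wrt (F k) V ->
    abs_exp P (fun w => V w * C k.+1 w * Lambda k.+1 w) =
    abs_exp P (fun w => V w * C k w).
  move=> kN mV; have kN' := ltnW kN.
  have [_ fA] := evA _ kN; have [_ fAc] := evAc _ kN.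
  apply: (fair_density_asset (sF _ kN') (mF _ kN') (nF _ kN') fA fAc
    (AAc k) (mZT _ kN) (Z0 _ kN) (hEA _ kN) (hEAc _ kN) (mq _ kN) (q1 _ kN)
    (hLambdaA _ kN) (hLambdaAc _ kN) (mC _ kN') (mm _ kN) (ms _ kN)
    (hCpos _ kN') (hCpos _ kN) _ _ (mqs _ kN) mV).
  - apply: filterS (CS _ kN) => w -> Aw.
    by rewrite (Aw : incr b1 k w = 1); ring.
  - apply: filterS (CS _ kN) => w -> Aw.
    by rewrite (Aw : incr b1 k w = -1); ring.
split; first exact: (density_process_martingale hF mLam Lam0 ELam hQ mC hC0).
have hD' k : (k < N)%N -> is_cond_exp Q (F k) (D k.+1) (D k).
  move=> kN; have := hD _ kN.
  rewrite (_ : (fun w => _) = D k.+1)//.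
  by apply/funext => w; rewrite hphi mul0r addr0.
apply: martingale_of_steps => // n.
case: n => [_|n nN]; first by have [] := hD' _ hN.
by have [] := hD' _ nN.
Qed.
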